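(* Let $G$ be a locally compact abelian group, let all exponents $p,p_1,p_2,q,q_1,q_2,r,r_1,r_2$ lie in $[1,\infty)$, let $\vartheta_1,\vartheta_3$ be Beurling weights on $G$ and $\vartheta_2,\vartheta_4$ Beurling weights on the dual group $\widehat G$. Then: (i) If $p_2\le p_1$ and $r_1\le r_2$, then $A^{p_1,1,q,r_1}_{\vartheta_1,\vartheta_2}(G)\hookrightarrow A^{p_2,1,q,r_2}_{\vartheta_1,\vartheta_2}(G)$. (ii) If $\vartheta_3\prec\vartheta_1$ and $\vartheta_4\prec\vartheta_2$, then $A^{p,1,q,r}_{\vartheta_1,\vartheta_2}(G)$ is continuously embedded in $A^{p,1,q,r}_{\vartheta_3,\vartheta_4}(G)$. (iii) If $p_2\le p_1$ and $q_2\le q_1$, then $A^{p_1,1,q_1,r}_{\vartheta_1,\vartheta_2}(G)\hookrightarrow A^{p_2,1,q_2,r}_{\vartheta_1,\vartheta_2}(G)$. (iv) If $\vartheta_3\prec\vartheta_1$, $q_2\le q_1$ and $r_1\le r_2$, then $A^{p,1,q_1,r_1}_{\vartheta_1,\vartheta_2}(G)$ is continuously embedded in $A^{p,1,q_2,r_2}_{\vartheta_3,\vartheta_2}(G)$.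
   Context: ''$X\hookrightarrow Y$'' ($X$ is continuously embedded in $Y$) means $X\subset Y$ and there is $c>0$ with $\|f\|_Y\le c\|f\|_X$ for all $f\in X$. $\vartheta\prec\vartheta'$ means there is $C>0$ with $\vartheta(x)\le C\vartheta'(x)$ for all $x$. A Beurling weight on a locally compact abelian group $G$ is a measurable, locally integrable function $\vartheta:G\to(0,\infty)$ with $\vartheta(x)\ge 1$ and $\vartheta(x+y)\le\vartheta(x)\vartheta(y)$ for all $x,y\in G$. Amalgam spaces: by the structure theorem write $G=\mathbb R^a\times G_1$ with $a\ge 0$ an integer and $G_1$ a locally compact abelian group containing an open compact subgroup $H$. Put $I=[0,1)^a\times H$, $J=\mathbb Z^a\times T$ with $T$ a transversal of $H$ in $G_1$ (so $G_1=\bigcup_{t\in T}(t+H)$ is a coset decomposition), and $I_\alpha=\alpha+I$ for $\alpha\in J$; $G$ is the disjoint union of the $I_\alpha$, and Haar measure is normalized so that $I$ has measure $1$. For $1\le p,q<\infty$ let $\|f\|_{pq}=\big(\sum_{\alpha\in J}\|f\|_{L^p(I_\alpha)}^q\big)^{1/q}$. For a weight $\vartheta$, $(L^p_\vartheta,\ell^q)$ is the space of $f\in L^p_{loc}(G)$ (mod a.e. equality) with $\|f\|_{pq,\vartheta}:=\|f\vartheta\|_{pq}<\infty$. The same definitions are used on $\widehat G$. $\widehat f(\gamma)=\int_G f(x)\overline{\langle x,\gamma\rangle}\,dx$ is the Fourier transform. For Beurling weights $\vartheta$ on $G$ and $\omega$ on $\widehat G$, define $A^{p,1,q,r}_{\vartheta,\omega}(G)=\{f\in(L^p_{\vartheta},\ell^1):\widehat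 f\in(L^q_{\omega},\ell^r)\}$, the second space being taken on $\widehat G$, with norm $\|f\|^{p,1,q,r}_{\vartheta,\omega}=\|f\|_{p1,\vartheta}+\|\widehat f\|_{qr,\omega}$. *)

(* Defs.v *)
From HB Require Import structures.
From mathcomp Require Import all_boot all_order all_algebra complex.
From mathcomp Require Import all_classical all_reals all_analysis.

Set Implicit Arguments.
Unset Strict Implicit.
Unset Printing Implicit Defensive.

Import Order.TTheory GRing.Theory Num.Theory.
Import numFieldNormedType.Exports.

Local Open Scope classical_set_scope.
Local Open Scope ring_scope.
Local Open Scope complex_scope.

Section dual_group.
Variables (R : realType) (G : topologicalZmodType).

(* The dual group, written additively: [a + b] is the pointwise product of the
   characters [a] and [b], [- a] is the complex conjugate of [a], and the
   topology is the compact-open one. *)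
Record dual := Character {
  char_fun :> G -> R[i] ;
  char_continuous : continuous (char_fun : G -> R[i]^o) ;
  charD : forall x y, char_fun (x + y) = char_fun x * char_fun y ;
  char_norm : forall x, `|char_fun x| = 1 }.

HB.instance Definition _ := gen_eqMixin dual.
HB.instance Definition _ := gen_choiceMixin dual.

Lemma dual_ext (a b : dual) : a =1 b -> a = b.
Proof.
case: a b => [a ca da na] [b cb db nb] /= /funext ab; subst b.
by congr Character; exact: Prop_irrelevance.
Qed.

Lemma normr_conj_char (a : dual) x : `|(a x)^*| = 1.
Proof. by rewrite normcJ char_norm. Qed.

Lemma char_mulVr (a : dual) x : (a x)^* * a x = 1.
Proof. by rewrite mulrC -sqr_normc char_norm expr1n. Qed.

Lemma conjc_continuous : continuous (conjc : R[i]^o -> R[i]^o).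
Proof.
move=> z A /nbhs_ballP[e e0 eA]; apply/nbhs_ballP; exists e => // t zt.
by apply: eA; move: zt; rewrite -ball_normE /= -rmorphB normcJ.
Qed.

Definition dual_zero : dual.
Proof.
by exists (cst 1) => [|x y|x]; [exact: cst_continuous | rewrite mulr1
  | rewrite normr1].
Defined.

Definition dual_opp (a : dual) : dual.
Proof.
exists (fun x => (a x)^*) => [x|x y|x].
- by apply: (@continuous_comp _ _ _ (a : G -> R[i]^o) (conjc : R[i]^o -> R[i]^o));
    [exact: char_continuous | exact: conjc_continuous].
- by rewrite charD rmorphM.
- exact: normr_conj_char.
Defined.

Definition dual_add (a b : dual) : dual.
Proof.
exists (fun x => a x * b x) => [x|x y|x].
- by apply: (@continuousM _ _ (a : G -> R[i]^o) (b : G -> R[i]^o));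
    exact: char_continuous.
- by rewrite !charD mulrACA.
- by rewrite normrM !char_norm mulr1.
Defined.

Lemma dual_addA : associative dual_add.
Proof. by move=> a b c; apply: dual_ext => x /=; rewrite mulrA. Qed.

Lemma dual_addC : commutative dual_add.
Proof. by move=> a b; apply: dual_ext => x /=; rewrite mulrC. Qed.

Lemma dual_add0 : left_id dual_zero dual_add.
Proof. by move=> a; apply: dual_ext => x /=; rewrite mul1r. Qed.

Lemma dual_addN : left_inverse dual_zero dual_opp dual_add.
Proof. by move=> a; apply: dual_ext => x /=; rewrite char_mulVr. Qed.

HB.instance Definition _ :=
  GRing.isZmodule.Build dual dual_addA dual_addC dual_add0 dual_addN.

Definition dual_val (a : dual) : {compact-open, G -> R[i]^o} := a.

HB.instance Definition _ :=
  Topological.copy dual (initial_topology dual_val).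

Lemma nbhs_dual (a : dual) (K : set G) (e : R[i]) : compact K -> 0 < e ->
  nbhs a [set b : dual | forall x, K x -> `|a x - b x| < e].
Proof.
move=> cK e0.
have ca : {compact-open, dual_val @ a --> dual_val a}.
  exact: (@initial_continuous dual).
have FF : Filter (dual_val @ a) := fmap_filter _ (nbhs_filter a).
have fa : {family compact, dual_val @ a --> dual_val a}.
  exact: (proj1 (@compact_open_fam_compactP G R[i]^o (dual_val a)
    (dual_val @ a) (@char_continuous a) FF) ca).
have /fam_cvgP/(_ K cK) := fa.
move=> /(_ [set g | forall x, K x -> `|a x - g x| < e]); apply.
apply/uniform_nbhs; exists [set xy : R[i]^o * R[i]^o | `|xy.1 - xy.2| < e].
split => //.
by rewrite -entourage_ballE; exists e.
Qed.

Lemma dual_sub_continuous : continuous (fun ab : dual * dual => ab.1 - ab.2).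
Proof.
apply: (@continuous_comp_initial dual) => -[a b].
apply/compact_open_fam_compactP; first exact: char_continuous.
apply/fam_cvgP => K cK P /uniform_nbhs[E [entE EP]].
move: entE; rewrite -entourage_ballE => -[e /= e0 eE].
have e20 : 0 < e / 2 by rewrite divr_gt0.
suff : nbhs (a, b) [set cd : dual * dual |
    forall x, K x -> E (a x * (b x)^*, cd.1 x * (cd.2 x)^*)].
  by apply: filterS => cd; exact: EP.
exists ([set c : dual | forall x, K x -> `|a x - c x| < e / 2],
        [set d : dual | forall x, K x -> `|b x - d x| < e / 2]).
  by split; exact: nbhs_dual.
move=> [c d] /= [cP dP] x Kx; apply: eE; rewrite /= -ball_normE /=.
have -> : a x * (b x)^* - c x * (d x)^* =
    (a x - c x) * (b x)^* + c x * (b x - d x)^*.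
  by rewrite rmorphB mulrBl mulrBr addrA subrK.
rewrite (le_lt_trans (ler_normD _ _))// !normrM normr_conj_char char_norm.
by rewrite mulr1 mul1r normcJ [e]splitr ltrD ?cP ?dP.
Qed.

HB.instance Definition _ :=
  PreTopologicalNmodule_isTopologicalZmodule.Build dual dual_sub_continuous.

End dual_group.

Arguments dual R G : clear implicits.

Section borel.
Variable G : topologicalZmodType.

Definition borel : Type := G.

HB.instance Definition _ := Choice.on borel.
HB.instance Definition _ := isPointed.Build borel (0 : G).

Let B : set (set borel) := open.

HB.instance Definition _ := @isMeasurable.Build (sigma_display B)
  borel <<s B >> (@sigma_algebra0 _ setT B) (@sigma_algebraC _ B)
  (@sigma_algebra_bigcup _ setT B).

End borel.

(* Inner regularity is required for all Borel sets, not just the open ones.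
   For sigma-compact [G] this is no restriction; in general it selects the
   version of Haar measure for which locally null Borel sets are null, so that
   "almost everywhere" is unambiguous and a function of [(L^p, l^1)] is
   integrable. *)
Record haar_measure (R : realType) (G : topologicalZmodType)
    (mu : {measure set (borel G) -> \bar R}) : Prop := {
  haar_neq0 : mu [set: borel G] != 0%E ;
  haar_translate : forall (x : G) (A : set (borel G)), measurable A ->
    mu [set x + y | y in (A : set G)] = mu A ;
  haar_compact : forall K : set G, compact K -> (mu K < +oo)%E ;
  haar_inner_regular : forall A : set (borel G), measurable A ->
    mu A = ereal_sup [set mu K | K in [set K : set G | compact K /\ K `<=` A]] }.

(* A topological isomorphism of [G] with [R^a * G_1], an open compact subgroup
   [H] of [G_1] and a transversal [T] of [H] in [G_1]. *)
Record splitting (R : realType) (G : topologicalZmodType) := Splitting {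
  rdim : nat ;
  cpart : topologicalZmodType ;
  split_iso : G -> 'rV[R]_rdim * cpart ;
  split_inv : 'rV[R]_rdim * cpart -> G ;
  splitK : cancel split_iso split_inv ;
  split_invK : cancel split_inv split_iso ;
  splitD : {morph split_iso : x y / x + y} ;
  split_continuous : continuous split_iso ;
  split_inv_continuous : continuous split_inv ;
  cpart_hausdorff : hausdorff_space cpart ;
  cpart_locally_compact : locally_compact [set: cpart] ;
  csub : set cpart ;
  csub0 : csub 0 ;
  csubB : forall x y, csub x -> csub y -> csub (x - y) ;
  csub_open : open csub ;
  csub_compact : compact csub ;
  transversal : set cpart ;
  transversalP : forall x, exists! t, transversal t /\ csub (x - t) }.

Section amalgam.
Variables (R : realType) (G : topologicalZmodType).
Variable S : splitting R G.
Implicit Types (mu : {measure set (borel G) -> \bar R}) (f : G -> R[i]).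
Implicit Types (w : G -> R) (p q : R).

Definition base_cell : set G := [set x |
  (forall i, 0 <= (split_iso S x).1 ord0 i < 1) /\ csub (split_iso S x).2].

Definition cell_index : set G := [set x |
  (forall i, (split_iso S x).1 ord0 i \is a Num.int) /\
  transversal (split_iso S x).2].

Definition cell (alpha : G) : set G := [set alpha + x | x in base_cell].

Definition normalized_haar_measure mu :=
  haar_measure mu /\ mu base_cell = 1%E.

Definition cmeasurable f :=
  measurable_fun [set: borel G] ((fun x => complex.Re (f x)) : borel G -> R) /\
  measurable_fun [set: borel G] ((fun x => complex.Im (f x)) : borel G -> R).

Definition Lp_loc mu p : set (G -> R[i]) := [set f | cmeasurable f /\
  forall K : set G, compact K ->
    (\int[mu]_(x in (K : set (borel G))) (Normc.normc (f x) `^ p)%:E < +oo)%E].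

Definition cell_norm mu p f (alpha : G) : \bar R :=
  'N[mu]_(p%:E) [(fun x : borel G => (Normc.normc (f x))%:E) \_ (cell alpha)].

Definition amalgam_norm mu p q f : \bar R :=
  ((\esum_(alpha in cell_index) (cell_norm mu p f alpha `^ q)) `^ q^-1)%E.

Definition weighted_amalgam_norm mu w p q f : \bar R :=
  amalgam_norm mu p q (fun x => f x * (w x)%:C).

(* Elements are represented by Borel functions: classes modulo equality a.e.
   are not formed, membership and norm being insensitive to null sets. *)
Definition amalgam mu w p q : set (G -> R[i]) :=
  [set f | Lp_loc mu p f /\ (weighted_amalgam_norm mu w p q f < +oo)%E].

End amalgam.

Definition beurling_weight (R : realType) (G : topologicalZmodType)
    (mu : {measure set (borel G) -> \bar R}) (w : G -> R) :=
  [/\ measurable_fun [set: borel G] (w : borel G -> R),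
      forall K : set G, compact K ->
        (\int[mu]_(x in (K : set (borel G))) (w x)%:E < +oo)%E,
      forall x, 1 <= w x &
      forall x y, w (x + y) <= w x * w y].

Definition weight_le (R : realType) (T : Type) (w w' : T -> R) :=
  exists2 C : R, 0 < C & forall x, w x <= C * w' x.

Definition cintegral (R : realType) d (T : measurableType d)
    (mu : {measure set T -> \bar R}) (f : T -> R[i]) : R[i] :=
  (\int[mu]_x complex.Re (f x)) +i* (\int[mu]_x complex.Im (f x)).

Definition fourier (R : realType) (G : topologicalZmodType)
    (mu : {measure set (borel G) -> \bar R}) (f : G -> R[i]) :
    dual R G -> R[i] :=
  fun gamma => cintegral mu (fun x : borel G => f x * (gamma x)^*).

Record function_space (R : realType) (T : Type) := FunctionSpace {
  carrier : set (T -> R[i]) ;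
  space_norm : (T -> R[i]) -> \bar R }.

Definition cts_embedded (R : realType) (T : Type) (X Y : function_space R T) :=
  carrier X `<=` carrier Y /\
  exists2 c : R, 0 < c &
    forall f, carrier X f -> (space_norm Y f <= c%:E * space_norm X f)%E.

Definition A_space (R : realType) (G : topologicalZmodType)
    (S : splitting R G) (S' : splitting R (dual R G))
    (mu : {measure set (borel G) -> \bar R})
    (nu : {measure set (borel (dual R G)) -> \bar R})
    (theta : G -> R) (omega : dual R G -> R) (p q r : R) :
    function_space R G :=
  {| carrier := [set f | amalgam S mu theta p 1 f /\
                         amalgam S' nu omega q r (fourier mu f)] ;
     space_norm := fun f => (weighted_amalgam_norm S mu theta p 1 f +
                   weighted_amalgam_norm S' nu omega q r (fourier mu f))%E |}.

(* Main.v *)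
Require Import Defs.
From HB Require Import structures.
From mathcomp Require Import all_boot all_order all_algebra complex.
From mathcomp Require Import all_classical all_reals all_analysis.
From mathcomp Require Import measurable_realfun.
Import Order.TTheory GRing.Theory Num.Theory.
Import numFieldNormedType.Exports.
Local Open Scope classical_set_scope.
Local Open Scope ring_scope.

Set Implicit Arguments.
Unset Strict Implicit.
Unset Printing Implicit Defensive.

(** An amalgam norm is an l^q norm, over the cells, of local L^p norms, and
    its two exponents have opposite monotonicity. Every cell is a translate of
    the base cell, so it has measure 1, and by Hoelder's inequality the local
    norm on it decreases when p decreases ([le_cell_norm_exponent]). The outer
    sum is over a discrete set with counting measure, so there the norm
    decreases when q increases ([le_esum_lq]). Both inequalities hold with
    constant 1; a pointwise domination of the weights by a factor C multiplies
    the norm by at most C. Together these give [le_amalgam_norm].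

    Elements of an amalgam space must also be locally p-th power integrable.
    This passes to smaller p by the same Hoelder inequality
    ([le_integral_powR]), now on compact sets, whose Haar measure is finite.
    Compact sets are Borel because the splitting makes the group Hausdorff,
    which is how the dual group is seen to be Hausdorff.

    The embeddings of the spaces A then come from applying the amalgam
    embedding [amalgam_subset] on the group to f and on the dual group to the
    Fourier transform of f, which belongs to an amalgam space by the very
    definition of A. All four claims are instances of the single embedding
    [A_space_embedded], in which the exponents and the weights vary
    simultaneously. *)

(** * Power inequalities for integrals and sums *)

(** Hoelder's inequality for the product of g^s and the indicator of D, with
    exponents t/s and its conjugate. For [s = t] the conjugate exponent is
    infinite and the claim is an equality. On a set of measure 1 it compares
    L^s and L^t norms; on a set of finite measure it shows that t-th power
    integrability implies s-th power integrability. *)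
Lemma le_integral_powR d (T : measurableType d) (R : realType)
    (mu : {measure set T -> \bar R}) (D : set T) (g : T -> R) (s t : R) :
  measurable D -> measurable_fun [set: T] g -> (forall x, 0 <= g x) ->
  0 < s -> s <= t ->
  (\int[mu]_(x in D) (g x `^ s)%:E <=
   (\int[mu]_(x in D) (g x `^ t)%:E) `^ (s / t) * mu D `^ (1 - s / t))%E.
Proof.
move=> mD mg g0 s0; rewrite le_eqVlt => /predU1P[<-|st].
  rewrite divff ?gt_eqF// subrr poweRe0 mule1 poweRe1//.
  by apply: integral_ge0 => x _; rewrite lee_fin powR_ge0.
have t0 : 0 < t := lt_trans s0 st.
pose r := t / s; pose r' := (1 - r^-1)^-1.
have rV : r^-1 = s / t by rewrite /r invf_div.
have r0 : 0 < r by rewrite divr_gt0.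
have r'0 : 0 < r' by rewrite invr_gt0 subr_gt0 rV ltr_pdivrMr// mul1r.
have rr' : r^-1 + r'^-1 = 1 by rewrite invrK subrKC.
have mgs : measurable_fun [set: T] (fun x => g x `^ s).
  exact: (measurableT_comp (measurable_powR s)).
have mf : measurable_fun [set: T] ((fun x => g x `^ s) \_ D).
  by apply/(measurable_restrictT _ mD); exact: measurable_funTS.
have mi : measurable_fun [set: T] (\1_D : T -> R) by exact: measurable_indic.
have := @hoelder _ _ _ mu _ _ _ _ mf mi r0 r'0 rr'.
rewrite Lnorm1.
rewrite [X in (X <= _)%E](_ : _ =
    \int[mu]_(x in D) (g x `^ s)%:E)%E; last first.
  rewrite [RHS]integral_mkcond; apply: eq_integral => x _.
  rewrite /= indicE !patchE; case: (x \in D) => /=.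
    by rewrite mulr1 ger0_norm// powR_ge0.
  by rewrite mul0r normr0.
move=> /le_trans; apply.
rewrite unlock /Lnorm rV invrK.
rewrite [X in (X `^ _ * _)%E](_ : _ =
    \int[mu]_(x in D) (g x `^ t)%:E)%E; last first.
  rewrite [RHS]integral_mkcond; apply: eq_integral => x _.
  rewrite /= !patchE; case: (x \in D) => /=.
    by rewrite ger0_norm ?powR_ge0// -powRrM mulrCA divff ?mulr1// gt_eqF.
  by rewrite normr0 powR0// gt_eqF.
rewrite [X in (_ * X `^ _)%E](_ : _ = mu D); last first.
  rewrite -[D in RHS]setIT -integral_indic//; apply: eq_integral => x _.
  rewrite /= indicE; case: (x \in D) => /=.
    by rewrite normr1 powR1.
  by rewrite normr0 powR0// gt_eqF.
by rewrite rV.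
Qed.

Lemma esum_mulrl (R : realType) (T : choiceType) (I : set T) (c : R)
    (a : T -> \bar R) : 0 <= c -> (forall i, 0 <= a i)%E ->
  (\esum_(i in I) (c%:E * a i) = c%:E * \esum_(i in I) a i)%E.
Proof.
move=> c0 a0; rewrite /esum -ereal_supZl//; last first.
  apply/set0P; exists (\sum_(x \in set0) a x)%E; exists set0 => //.
  exact: fsets_set0.
congr ereal_sup; rewrite image_comp; apply: eq_imagel => X _ /=.
by rewrite ge0_mule_fsumr.
Qed.

Lemma le_poweR (R : realType) (t : R) (x y : \bar R) :
  0 <= t -> (0 <= x)%E -> (x <= y)%E -> (x `^ t <= y `^ t)%E.
Proof.
move=> t0 x0 xy; apply: gt0_ler_poweR => //; rewrite in_itv/= ?x0 leey//.
by rewrite (le_trans x0 xy).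
Qed.

Lemma poweRK (R : realType) (t : R) (x : \bar R) :
  0 < t -> (0 <= x)%E -> ((x `^ t) `^ t^-1 = x)%E.
Proof. by move=> t0 x0; rewrite -poweRrM divff ?gt_eqF// poweRe1. Qed.

Lemma poweRVK (R : realType) (t : R) (x : \bar R) :
  0 < t -> (0 <= x)%E -> ((x `^ t^-1) `^ t = x)%E.
Proof. by move=> t0 x0; rewrite poweRAC poweRK. Qed.

(** Let the l^s norm N be finite. Each term is at most N, since the sum dominates each of its
    terms. Hence a_i^t <= N^(t-s) a_i^s, and summation over i gives
    N^(t-s) N^s = N^t. *)
Lemma le_esum_lq (R : realType) (T : choiceType) (I : set T)
    (a : T -> \bar R) (s t : R) : (forall i, 0 <= a i)%E -> 0 < s -> s <= t ->
  ((\esum_(i in I) a i `^ t) `^ t^-1 <= (\esum_(i in I) a i `^ s) `^ s^-1)%E.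
Proof.
move=> a0 s0 st; have t0 : 0 < t := lt_le_trans s0 st.
have S0 : (0 <= \esum_(i in I) a i `^ s)%E.
  by apply: esum_ge0 => i _; exact: poweR_ge0.
have T0 : (0 <= \esum_(i in I) a i `^ t)%E.
  by apply: esum_ge0 => i _; exact: poweR_ge0.
set N := ((\esum_(i in I) a i `^ s) `^ s^-1)%E.
have N0 : (0 <= N)%E by exact: poweR_ge0.
have [->|Ny] := eqVneq N +oo%E; first exact: leey.
have Nfin : N \is a fin_num by rewrite ge0_fin_numE// lt_neqAle Ny leey.
have aN i : I i -> (a i <= N)%E.
  move=> Ii; rewrite -[leLHS](poweRK s0)//; apply: le_poweR;
    rewrite ?invr_ge0 ?poweR_ge0 ?(ltW s0)//.
  apply: esum_ge; exists [set i]; first by split=> // j ->.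
  by rewrite fsbig_set1.
rewrite -[leRHS](poweRK t0)//.
apply: le_poweR => //; first by rewrite invr_ge0 ltW.
(* The law x^(u + v) = x^u x^v needs u + v != 0 or x != 0; the degenerate
   exponent t - s = 0 is therefore set apart. *)
have [ts0|ts0] := eqVneq (t - s) 0.
  by rewrite -(subrK s t) ts0 add0r /N poweRVK.
have split_pow x : (0 <= x -> x `^ t = x `^ (t - s) * x `^ s)%E.
  by move=> x0; rewrite -poweRD ?subrK// add_neq0_poweRD_def// subrK gt_eqF.
rewrite [leRHS]split_pow// {2}/N poweRVK//.
rewrite -(fineK (fin_num_poweR (t - s) Nfin)).
rewrite -esum_mulrl ?fine_ge0 ?poweR_ge0//; last by move=> i; exact: poweR_ge0.
apply: le_esum => i Ii.
rewrite (fineK (fin_num_poweR (t - s) Nfin)) (split_pow (a i))//.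
by rewrite lee_wpmul2r ?poweR_ge0// le_poweR ?subr_ge0 ?aN.
Qed.

(** * Borel sets and Borel functions *)

Section borel.
Context (R : realType) (G : topologicalZmodType).
Implicit Types (f : G -> R[i]) (w : G -> R) (p : R).

Lemma open_borel_measurable (A : set G) :
  open A -> measurable (A : set (borel G)).
Proof. by move=> oA; apply: sub_sigma_algebra. Qed.

Lemma closed_borel_measurable (A : set G) :
  closed A -> measurable (A : set (borel G)).
Proof.
move=> cA; rewrite -[A]setCK; apply: measurableC.
by apply: open_borel_measurable; exact: closed_openC.
Qed.

Lemma normc_ge0 (z : R[i]) : 0 <= Normc.normc z.
Proof. by case: z => x y; exact: sqrtr_ge0. Qed.

Lemma normcM_real (z : R[i]) (x : R) : 0 <= x ->
  Normc.normc (z * x%:C%C) = Normc.normc z * x.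
Proof.
by move=> x0; rewrite Normc.normcM /= expr0n /= addr0 sqrtr_sqr ger0_norm.
Qed.

Lemma measurable_normc f : cmeasurable f ->
  measurable_fun [set: borel G] ((fun x => Normc.normc (f x)) : borel G -> R).
Proof.
move=> [mre mim].
rewrite (_ : (fun x => _) = Num.sqrt \o
    (fun x => complex.Re (f x) ^+ 2 + complex.Im (f x) ^+ 2)); last first.
  by apply/funext => x /=; case: (f x).
apply: (measurableT_comp (continuous_measurable_fun (@sqrt_continuous R))).
by apply: measurable_funD; exact: measurable_funX.
Qed.

Lemma measurable_normc_powR f p : cmeasurable f ->
  measurable_fun [set: borel G]
    ((fun x => (Normc.normc (f x) `^ p)%:E) : borel G -> \bar R).
Proof.
move=> mf; apply/measurable_EFinP.
exact: (measurableT_comp (measurable_powR p) (measurable_normc mf)).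
Qed.

Lemma cmeasurableM_real f w : cmeasurable f ->
  measurable_fun [set: borel G] (w : borel G -> R) ->
  cmeasurable (fun x => f x * (w x)%:C%C).
Proof.
move=> [mre mim] mw; split.
  rewrite (_ : (fun x => _) = (fun x => complex.Re (f x) * w x)).
    exact: measurable_funM.
  by apply/funext => x; case: (f x) => u v /=; rewrite mulr0 subr0.
rewrite (_ : (fun x => _) = (fun x => complex.Im (f x) * w x)).
  exact: measurable_funM.
by apply/funext => x; case: (f x) => u v /=; rewrite mulr0 add0r.
Qed.

End borel.

(** * Topology and cells of a split group *)

Section splitting.
Context (R : realType) (G : topologicalZmodType) (S : splitting R G).

(** The splitting is a continuous injection into the product of two Hausdorff
    spaces. *)
Lemma splitting_hausdorff : hausdorff_space G.
Proof.
move=> x y xy.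
apply: (can_inj (Defs.splitK S)); apply: injective_projections.
  apply: (@norm_hausdorff _ 'rV[R]_(rdim S)) => A B nA nB.
  have cf z : {for z, continuous (fun x => (split_iso S x).1)}.
    by apply: continuous_comp; [exact: split_continuous | exact: cvg_fst].
  have [z [Az Bz]] := xy _ _ (cf x A nA) (cf y B nB).
  by exists (split_iso S z).1.
apply: cpart_hausdorff => A B nA nB.
have cf z : {for z, continuous (fun x => (split_iso S x).2)}.
  by apply: continuous_comp; [exact: split_continuous | exact: cvg_snd].
have [z [Az Bz]] := xy _ _ (cf x A nA) (cf y B nB).
by exists (split_iso S z).2.
Qed.

(** Preimages under continuous maps are easier to measure than images, hence
    the description of a translated cell as a preimage. *)
Lemma cellE (a : G) : cell S a = [set x | base_cell S (x - a)].
Proof.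
apply/seteqP; split=> [x [y By <-]|x Bx] /=; first by rewrite addrC addKr.
by exists (x - a); rewrite // addrC subrK.
Qed.

(** In each real coordinate [0,1) is the intersection of a closed and an open
    half-line, and the remaining condition is membership in an open
    subgroup. *)
Lemma cell_measurable (a : G) : measurable (cell S a : set (borel G)).
Proof.
rewrite cellE.
have cs : continuous (fun x : G => x - a).
  move=> x; apply: (continuous_comp (f := fun x : G => (x, - a))
    (g := fun z => z.1 + z.2)).
    by apply: cvg_pair => //=; exact: cvg_cst.
  exact: add_continuous.
have cf : continuous (fun x : G => split_iso S (x - a)).
  move=> x; apply: (continuous_comp (f := fun x : G => x - a)); first exact: cs.
  exact: split_continuous.
pose u i (x : G) := (split_iso S (x - a)).1 ord0 i.
have cu i : continuous (u i).
  move=> x; apply: (continuous_comp (f := fun x : G => (split_iso S (x - a)).1)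
     (g := fun M : 'rV[R]_(rdim S) => M ord0 i)); last exact: coord_continuous.
  by apply: (continuous_comp (f := fun x : G => split_iso S (x - a))
    (g := fst)); [exact: cf | exact: cvg_fst].
rewrite (_ : [set x | _] = (\bigcap_(i in [set: 'I_(rdim S)])
   ([set x | 0 <= u i x] `&` [set x | u i x < 1])) `&`
   [set x | csub (split_iso S (x - a)).2]); last first.
  apply/seteqP; split=> x [/= Hu Hc]; split=> // i.
    by move=> _; apply/andP; exact: Hu.
  by apply/andP; exact: Hu.
apply: measurableI.
  apply: fin_bigcap_measurable => // i _; apply: measurableI.
    apply: closed_borel_measurable.
    exact: (preimage_closed (f := u i) (fun x _ => cu i x) (@closed_ge R 0)).
  apply: open_borel_measurable.
  exact: (open_comp (f := u i) (fun x _ => cu i x) (@open_lt R 1)).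
apply: open_borel_measurable.
have c2 : continuous (fun x : G => (split_iso S (x - a)).2).
  move=> x; apply: (continuous_comp (f := fun x : G => split_iso S (x - a))
    (g := snd)); [exact: cf | exact: cvg_snd].
exact: (open_comp (fun x _ => c2 x) (csub_open S)).
Qed.

End splitting.

(** * Monotonicity of the amalgam norm *)

Section amalgam_monotonicity.
Context (R : realType) (G : topologicalZmodType) (S : splitting R G).
Context (mu : {measure set (borel G) -> \bar R}).
Context (haar_mu : normalized_haar_measure S mu).
Implicit Types (f g : G -> R[i]) (w : G -> R) (a : G) (p q : R).

Lemma measure_cell a : mu (cell S a) = 1%E.
Proof.
have [[_ translate _ _] <-] := haar_mu; apply: translate.
rewrite (_ : base_cell S = cell S 0); first exact: cell_measurable.
by rewrite cellE; apply/funext => x /=; rewrite subr0.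
Qed.

Lemma cell_normE p f a : 0 < p ->
  cell_norm S mu p f a =
    ((\int[mu]_(x in (cell S a : set (borel G))) (Normc.normc (f x) `^ p)%:E)
      `^ p^-1)%E.
Proof.
move=> p0; rewrite /cell_norm unlock /Lnorm; congr poweR.
rewrite [RHS]integral_mkcond; apply: eq_integral => x _.
rewrite !patchE; case: (x \in _) => /=.
  by rewrite ger0_norm ?normc_ge0.
by rewrite normr0 powR0// gt_eqF.
Qed.

Lemma cell_norm_ge0 p f a : (0 <= cell_norm S mu p f a)%E.
Proof. exact: Lnorm_ge0. Qed.

Lemma amalgam_norm_ge0 p q f : (0 <= amalgam_norm S mu p q f)%E.
Proof. exact: poweR_ge0. Qed.

Lemma integral_cell_ge0 p f a :
  (0 <= \int[mu]_(x in (cell S a : set (borel G)))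
          (Normc.normc (f x) `^ p)%:E)%E.
Proof. by apply: integral_ge0 => x _; rewrite lee_fin powR_ge0. Qed.

(** The factor that Hoelder's inequality takes from the measure of the domain
    is 1 on a cell. *)
Lemma le_cell_norm_exponent p1 p2 f a : cmeasurable f -> 0 < p2 -> p2 <= p1 ->
  (cell_norm S mu p2 f a <= cell_norm S mu p1 f a)%E.
Proof.
move=> mf p20 p21; have p10 := lt_le_trans p20 p21.
rewrite !cell_normE//.
have -> : p1^-1 = p2 / p1 * p2^-1 by rewrite mulrAC divff ?gt_eqF ?mul1r.
rewrite poweRrM; apply: le_poweR;
  rewrite ?invr_ge0 ?(ltW p20) ?integral_cell_ge0//.
apply: le_trans (le_integral_powR mu (cell_measurable S a)
  (measurable_normc mf) _ p20 p21) _; first by move=> x; exact: normc_ge0.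
by rewrite measure_cell poweR1r mule1.
Qed.

Lemma le_cell_norm p (C : R) f g a : cmeasurable f -> cmeasurable g -> 0 < p ->
  0 <= C -> (forall x, Normc.normc (f x) <= C * Normc.normc (g x)) ->
  (cell_norm S mu p f a <= C%:E * cell_norm S mu p g a)%E.
Proof.
move=> mf mg p0 C0 fg; rewrite !cell_normE//.
have Cp : (C%:E = ((C `^ p)%:E) `^ p^-1)%E.
  by rewrite -poweR_EFin poweRK.
rewrite Cp -poweRM ?integral_cell_ge0 ?lee_fin ?powR_ge0//.
apply: le_poweR; rewrite ?invr_ge0 ?(ltW p0) ?integral_cell_ge0//.
have mT h : cmeasurable h -> measurable_fun (cell S a : set (borel G))
    ((fun x => (Normc.normc (h x) `^ p)%:E) : borel G -> \bar R).
  by move=> mh; apply: measurable_funTS; exact: measurable_normc_powR.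
rewrite -ge0_integralZl_EFin ?powR_ge0//; last 3 first.
- exact: cell_measurable.
- by move=> x _; rewrite lee_fin powR_ge0.
- exact: mT.
apply: ge0_le_integral.
- exact: cell_measurable.
- by move=> x _; rewrite lee_fin powR_ge0.
- exact: mT.
- by apply: measurable_funeM; exact: mT.
- move=> x _; rewrite -EFinM lee_fin -powRM ?normc_ge0//.
  by rewrite ge0_ler_powR ?nnegrE ?(ltW p0) ?normc_ge0// mulr_ge0 ?normc_ge0.
Qed.

Lemma le_amalgam_norm (C : R) p1 p2 q1 q2 f g :
  cmeasurable f -> cmeasurable g -> 0 < p2 -> p2 <= p1 -> 0 < q1 -> q1 <= q2 ->
  0 <= C -> (forall x, Normc.normc (f x) <= C * Normc.normc (g x)) ->
  (amalgam_norm S mu p2 q2 f <= C%:E * amalgam_norm S mu p1 q1 g)%E.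
Proof.
move=> mf mg p20 p21 q10 q12 C0 fg.
apply: (le_trans (le_esum_lq _ (fun a => cell_norm_ge0 p2 f a) q10 q12)).
have Cq : (C%:E = ((C `^ q1)%:E) `^ q1^-1)%E.
  by rewrite -poweR_EFin poweRK.
have S0 h p : (0 <= \esum_(a in cell_index S) cell_norm S mu p h a `^ q1)%E.
  by apply: esum_ge0 => a _; exact: poweR_ge0.
rewrite /amalgam_norm Cq -poweRM ?lee_fin ?powR_ge0//.
apply: le_poweR; rewrite ?invr_ge0 ?(ltW q10)//.
rewrite -esum_mulrl ?powR_ge0//; last by move=> a; exact: poweR_ge0.
apply: le_esum => a _; rewrite -poweR_EFin -poweRM ?cell_norm_ge0//.
apply: le_poweR; rewrite ?(ltW q10) ?cell_norm_ge0//.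
apply: le_trans (le_cell_norm_exponent a mf p20 p21) _.
by apply: le_cell_norm => //; exact: lt_le_trans p21.
Qed.

Lemma Lp_loc_exponent p1 p2 f : 0 < p2 -> p2 <= p1 ->
  Lp_loc mu p1 f -> Lp_loc mu p2 f.
Proof.
move=> p20 p21 [mf If]; split=> // K cK; have [[_ _ finK _] _] := haar_mu.
have mK : measurable (K : set (borel G)).
  apply: closed_borel_measurable; apply: compact_closed => //.
  exact: splitting_hausdorff S.
apply: le_lt_trans (le_integral_powR mu mK (measurable_normc mf) _ p20 p21) _.
  by move=> x; exact: normc_ge0.
apply: lte_mul_pinfty; rewrite ?poweR_ge0 ?poweR_lty ?finK//.
by rewrite ge0_fin_numE ?poweR_ge0 ?poweR_lty ?If.
Qed.

Lemma amalgam_subset w w' p1 p2 q1 q2 :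
  beurling_weight mu w -> beurling_weight mu w' -> weight_le w' w ->
  1 <= p2 -> p2 <= p1 -> 1 <= q1 -> q1 <= q2 ->
  exists2 C : R, 0 < C & forall f, amalgam S mu w p1 q1 f ->
    amalgam S mu w' p2 q2 f /\
    (weighted_amalgam_norm S mu w' p2 q2 f <=
     C%:E * weighted_amalgam_norm S mu w p1 q1 f)%E.
Proof.
move=> [mw _ w1 _] [mw' _ w'1 _] [C C0 ww'] p2_ge1 p21 q1_ge1 q12.
have p20 := lt_le_trans ltr01 p2_ge1.
exists C => // f [fLp fw].
have fle : (weighted_amalgam_norm S mu w' p2 q2 f <=
     C%:E * weighted_amalgam_norm S mu w p1 q1 f)%E.
  apply: le_amalgam_norm => //.
  - by apply: cmeasurableM_real => //; exact: fLp.1.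
  - by apply: cmeasurableM_real => //; exact: fLp.1.
  - exact: lt_le_trans q1_ge1.
  - exact: ltW.
  - move=> x; rewrite !normcM_real ?(le_trans ler01)// mulrCA.
    by rewrite ler_wpM2l ?normc_ge0.
split=> //; split; first exact: Lp_loc_exponent fLp.
by apply: le_lt_trans fle _; rewrite lte_mul_pinfty ?lee_fin ?ltW.
Qed.

End amalgam_monotonicity.

(** * Embeddings of the spaces A *)

Lemma weight_le_refl (R : realType) (T : Type) (w : T -> R) : weight_le w w.
Proof. by exists 1 => // x; rewrite mul1r. Qed.

(** The constants obtained on the group and on the dual group are added, so
    that their sum is at least each of them. *)
Lemma A_space_embedded (R : realType) (G : topologicalZmodType)
    (S : splitting R G) (S' : splitting R (dual R G))
    (mu : {measure set (borel G) -> \bar R})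
    (nu : {measure set (borel (dual R G)) -> \bar R})
    (theta theta' : G -> R) (omega omega' : dual R G -> R)
    (p1 p2 q1 q2 r1 r2 : R) :
  normalized_haar_measure S mu -> normalized_haar_measure S' nu ->
  beurling_weight mu theta -> beurling_weight mu theta' ->
  beurling_weight nu omega -> beurling_weight nu omega' ->
  weight_le theta' theta -> weight_le omega' omega ->
  1 <= p2 -> p2 <= p1 -> 1 <= q2 -> q2 <= q1 -> 1 <= r1 -> r1 <= r2 ->
  cts_embedded (A_space S S' mu nu theta omega p1 q1 r1)
               (A_space S S' mu nu theta' omega' p2 q2 r2).
Proof.
move=> hmu hnu wt wt' wo wo' tt' oo' p2_ge1 p21 q2_ge1 q21 r1_ge1 r12.
have [C C0 HC] := amalgam_subset hmu wt wt' tt' p2_ge1 p21 (lexx 1) (lexx 1).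
have [D D0 HD] := amalgam_subset hnu wo wo' oo' q2_ge1 q21 r1_ge1 r12.
split=> [f [/HC[fC _] /HD[fD _]] //|].
exists (C + D); first exact: addr_gt0.
move=> f [/HC[_ fC] /HD[_ fD]] /=.
rewrite ge0_muleDr ?amalgam_norm_ge0//; apply: leeD.
  apply: le_trans fC _; rewrite lee_wpmul2r ?amalgam_norm_ge0//.
  by rewrite lee_fin lerDl ltW.
apply: le_trans fD _; rewrite lee_wpmul2r ?amalgam_norm_ge0//.
by rewrite lee_fin lerDr ltW.
Qed.

Theorem theorem11 (R : realType) (G : topologicalZmodType)
    (hausG : hausdorff_space G) (lcG : locally_compact [set: G])
    (S : splitting R G) (S' : splitting R (dual R G))
    (mu : {measure set (borel G) -> \bar R})
    (nu : {measure set (borel (dual R G)) -> \bar R})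
    (haar_mu : normalized_haar_measure S mu)
    (haar_nu : normalized_haar_measure S' nu)
    (p p1 p2 q q1 q2 r r1 r2 : R)
    (hp : 1 <= p) (hp1 : 1 <= p1) (hp2 : 1 <= p2)
    (hq : 1 <= q) (hq1 : 1 <= q1) (hq2 : 1 <= q2)
    (hr : 1 <= r) (hr1 : 1 <= r1) (hr2 : 1 <= r2)
    (theta1 theta3 : G -> R) (theta2 theta4 : dual R G -> R)
    (w1 : beurling_weight mu theta1) (w3 : beurling_weight mu theta3)
    (w2 : beurling_weight nu theta2) (w4 : beurling_weight nu theta4) :
  [/\ p2 <= p1 -> r1 <= r2 ->
        cts_embedded (A_space S S' mu nu theta1 theta2 p1 q r1)
                     (A_space S S' mu nu theta1 theta2 p2 q r2),
      weight_le theta3 theta1 -> weight_le theta4 theta2 ->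
        cts_embedded (A_space S S' mu nu theta1 theta2 p q r)
                     (A_space S S' mu nu theta3 theta4 p q r),
      p2 <= p1 -> q2 <= q1 ->
        cts_embedded (A_space S S' mu nu theta1 theta2 p1 q1 r)
                     (A_space S S' mu nu theta1 theta2 p2 q2 r) &
      weight_le theta3 theta1 -> q2 <= q1 -> r1 <= r2 ->
        cts_embedded (A_space S S' mu nu theta1 theta2 p q1 r1)
                     (A_space S S' mu nu theta3 theta2 p q2 r2)].
Proof.
split.
- move=> p21 r12.
  exact: A_space_embedded (weight_le_refl _) (weight_le_refl _) _ _ _ _ _ _.
- by move=> t31 t42; apply: A_space_embedded.
- move=> p21 q21.
  exact: A_space_embedded (weight_le_refl _) (weight_le_refl _) _ _ _ _ _ _.
- move=> t31 q21 r12.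
  exact: A_space_embedded t31 (weight_le_refl _) _ _ _ _ _ _.
Qed.
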